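(* Let $(X,\mathscr A,\mu)$ be a $\sigma$-finite measure space, $w\colon X\to\mathbb C$ an $\mathscr A$-measurable function and $\phi\colon X\to X$ an $\mathscr A$-measurable transformation such that $\mu_w\circ\phi^{-1}\ll\mu$. Let $\alpha\in(0,1]$. If $C_{\phi,w}^k$ is densely defined for some integer $k\geqslant2$, then $C_{\phi,w_\alpha}$ is densely defined.
   Context: $\overline{\mathbb R}_+=[0,\infty]$. A transformation $\phi\colon X\to X$ is $\mathscr A$-measurable if $\phi^{-1}(\Delta)\in\mathscr A$ for all $\Delta\in\mathscr A$. $\mu_w(\Delta)=\int_\Delta|w|^2\,\mathrm d\mu$ and $\mu_w\circ\phi^{-1}(\Delta)=\mu_w(\phi^{-1}(\Delta))$ for $\Delta\in\mathscr A$. If $\mu_w\circ\phi^{-1}\ll\mu$, then $\mathsf h_{\phi,w}\colon X\to\overline{\mathbb R}_+$ is the ($\mu$-a.e. unique) Radon–Nikodym derivative: $\mu_w\circ\phi^{-1}(\Delta)=\int_\Delta\mathsf h_{\phi,w}\,\mathrm d\mu$, $\Delta\in\mathscr A$, and the weighted composition operator $C_{\phi,w}$ in $L^2(\mu)$ is defined by $\mathcal D(C_{\phi,w})=\{f\in L^2(\mu)\colon w\cdot(f\circ\phi)\in L^2(\mu)\}$, $C_{\phi,w}f=w\cdot(f\circ\phi)$; it is a closed operator and it is densely defined iff $\mathsf h_{\phi,w}<\infty$ a.e. $[\mu]$. Powers $C_{\phi,w}^k$ are taken with their natural domains. For $\alpha\in(0,1]$ and densely defined $C_{\phi,w}$,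 $w_\alpha\colon X\to\mathbb C$ is an $\mathscr A$-measurable function with $w_\alpha=w\cdot\big(\frac{\mathsf h_{\phi,w}}{\mathsf h_{\phi,w}\circ\phi}\big)^{\alpha/2}$ a.e. $[\mu]$ (one has $\mathsf h_{\phi,w}\circ\phi>0$ a.e. $[\mu_w]$; $w_\alpha=0$ a.e. on $\{w=0\}$). Moreover $\mu_{w_\alpha}\circ\phi^{-1}\ll\mu$, so $C_{\phi,w_\alpha}$ is defined. *)

(* Defs.v *)
From HB Require Import structures.
From mathcomp Require Import all_boot all_order all_algebra.
From mathcomp Require Import complex.
From mathcomp Require Import all_classical all_reals all_analysis.
From mathcomp Require Import measurable_realfun.

Set Implicit Arguments.
Unset Strict Implicit.
Unset Printing Implicit Defensive.
Import Order.TTheory GRing.Theory Num.Theory.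
Import numFieldNormedType.Exports.
Import ComplexField.

Local Open Scope classical_set_scope.
Local Open Scope ring_scope.

Section ComplexL2.
Context d (T : measurableType d) (R : realType).
Variable mu : {measure set T -> \bar R}.
Implicit Types f g : T -> R[i].

(* The library puts no sigma-algebra on R[i]; this is measurability for the
   Borel sigma-algebra of R^2. *)
Definition cmeasurable f :=
  measurable_fun setT (fun x => complex.Re (f x)) /\
  measurable_fun setT (fun x => complex.Im (f x)).

Definition cabs f : T -> R := fun x => Normc.normc (f x).

Definition L2norm f : \bar R := ('N[mu]_(2%:E) [EFin \o cabs f])%E.

(* Elements of L^2(mu) are handled through their representatives; L2norm is
   then a seminorm whose kernel is a.e. equality to 0. *)
Definition L2 : set (T -> R[i]) :=
  [set f | cmeasurable f /\ finite_norm mu 2%:E (cabs f)].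

(* An operator in L^2(mu), given by its domain and its action on
   representatives. *)
Record operator := Operator {
  dom : set (T -> R[i]);
  act : (T -> R[i]) -> (T -> R[i]) }.

Definition op_id : operator := Operator L2 id.

Definition op_comp (A B : operator) : operator :=
  Operator [set f | dom B f /\ dom A (act B f)] (act A \o act B).

(* D(A^(k+1)) = {f in D(A^k) : A^k f in D(A)} *)
Definition op_pow (A : operator) (k : nat) : operator :=
  iter k (op_comp A) op_id.

Definition densely_defined (A : operator) :=
  forall g, L2 g -> forall e : R, 0 < e ->
    exists2 f, dom A f & (L2norm (fun x => (f x - g x)%R) < e%:E)%E.

End ComplexL2.

Section WeightedComposition.
Context d (T : measurableType d) (R : realType).
Variable mu : {measure set T -> \bar R}.
Implicit Types (w : T -> R[i]) (phi : T -> T).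

Definition weighted w (A : set T) : \bar R :=
  (\int[mu]_(x in A) (cabs w x ^+ 2)%:E)%E.

(* When pushforward (weighted w) phi `<< mu, the operator below preserves
   a.e. equality of representatives, so it is an operator in L^2(mu). *)
Definition wcomp w phi : operator T R :=
  Operator [set f | L2 mu f /\ L2 mu (fun x => w x * f (phi x))]
           (fun f x => w x * f (phi x)).

(* The measure pushforward (weighted w) phi need not be sigma-finite, so that h
   may take the value +oo and the library's Radon_Nikodym does not apply. *)
Definition is_h w phi (h : T -> \bar R) :=
  [/\ measurable_fun setT h,
      forall x, (0 <= h x)%E &
      forall A, measurable A ->
        pushforward (weighted w) phi A = (\int[mu]_(x in A) h x)%E].

(* When wcomp w phi is densely defined, h < +oo a.e. [mu] and
   0 < h \o phi < +oo a.e. on {w != 0}, so [fine] and the division only take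
   default values on a null set or where the factor w x vanishes. *)
Definition is_w_alpha w phi (h : T -> \bar R) (alpha : R) (wa : T -> R[i]) :=
  cmeasurable wa /\
  {ae mu, forall x, wa x =
     w x * real_complex R ((fine (h x) / fine (h (phi x))) `^ (alpha / 2))}.

End WeightedComposition.

(* Main.v *)
(** Write [h] for the Radon-Nikodym derivative, [C] for [C_{phi,w}] and [1_n] for
    the indicator of [{h = 0} U {h >= 1/n}].  If [f] is in the domain of [C^2], then [1_n f] is in the domain of [C_{phi,w_alpha}]:
    since [t^alpha <= 1 + t] for [alpha <= 1],
      [|w_alpha|^2 |(1_n f) o phi|^2 <= (1 + n h) |C f|^2],
    and [h |C f|^2] is integrable, its integral being [||C^2 f||^2].  Finally
    [1_n f] tends to [f] in [L^2], and the domain of [C^2], which contains that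
    of [C^k], is dense. *)
Require Import Defs.
From HB Require Import structures.
From mathcomp Require Import all_boot all_order all_algebra.
From mathcomp Require Import complex.
From mathcomp Require Import all_classical all_reals all_analysis.
From mathcomp Require Import measurable_realfun.
From mathcomp Require Import ring.

Set Implicit Arguments.
Unset Strict Implicit.
Unset Printing Implicit Defensive.
Import Order.TTheory GRing.Theory Num.Theory.
Import numFieldNormedType.Exports.
Local Open Scope classical_set_scope.
Local Open Scope ring_scope.

(** * Complex square-integrable functions through the integral of [|f|^2] *)

Section SquareIntegral.
Context d (T : measurableType d) (R : realType).
Implicit Types (f g : T -> R[i]) (mu : {measure set T -> \bar R}).

Lemma cabs_ge0 f x : 0 <= cabs f x.
Proof. by rewrite /cabs; case: (f x) => a b; exact: sqrtr_ge0. Qed.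

Lemma cabsM f g x : cabs (fun y => f y * g y) x = cabs f x * cabs g x.
Proof. by rewrite /cabs Normc.normcM. Qed.

Lemma cabs_real (u : T -> R) x : cabs (fun y => real_complex R (u y)) x = `|u x|.
Proof. by rewrite /cabs /= expr0n addr0 sqrtr_sqr. Qed.

Lemma sqr_cabs f x : cabs f x ^+ 2 = complex.Re (f x) ^+ 2 + complex.Im (f x) ^+ 2.
Proof.
by rewrite /cabs; case: (f x) => a b /=; rewrite sqr_sqrtr// addr_ge0// sqr_ge0.
Qed.

Lemma cmeasurableM f g :
  cmeasurable f -> cmeasurable g -> cmeasurable (fun x => f x * g x).
Proof.
move=> [rf jf] [rg jg]; split.
- rewrite (_ : (fun _ => _) = (fun x => complex.Re (f x) * complex.Re (g x) -
      complex.Im (f x) * complex.Im (g x))); last first.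
    by apply/funext => x; case: (f x); case: (g x).
  by apply: measurable_funB; exact: measurable_funM.
- rewrite (_ : (fun _ => _) = (fun x => complex.Re (f x) * complex.Im (g x) +
      complex.Im (f x) * complex.Re (g x))); last first.
    by apply/funext => x; case: (f x) => a b; case: (g x).
  by apply: measurable_funD; exact: measurable_funM.
Qed.

Lemma cmeasurableB f g :
  cmeasurable f -> cmeasurable g -> cmeasurable (fun x => f x - g x).
Proof.
move=> [rf jf] [rg jg]; split.
- rewrite (_ : (fun _ => _) = (fun x => complex.Re (f x) - complex.Re (g x)));
    last by apply/funext => x; case: (f x); case: (g x).
  exact: measurable_funB.
- rewrite (_ : (fun _ => _) = (fun x => complex.Im (f x) - complex.Im (g x)));
    last by apply/funext => x; case: (f x); case: (g x).
  exact: measurable_funB.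
Qed.

Lemma cmeasurable_real (u : T -> R) : measurable_fun setT u ->
  cmeasurable (fun x => real_complex R (u x)).
Proof. by move=> mu; split => //=; exact: measurable_cst. Qed.

Lemma cmeasurable_comp f (phi : T -> T) : measurable_fun setT phi ->
  cmeasurable f -> cmeasurable (fun x => f (phi x)).
Proof.
move=> mphi [rf jf].
by split; [exact: (measurableT_comp rf mphi)|exact: (measurableT_comp jf mphi)].
Qed.

Lemma measurable_sqr_cabs f : cmeasurable f ->
  measurable_fun setT (fun x => cabs f x ^+ 2).
Proof.
move=> [rf jf]; under eq_fun do rewrite sqr_cabs.
by apply: measurable_funD; exact: measurable_funX.
Qed.

(** Squaring is strictly increasing on [[0, +oo]] and takes the norm to the integral. The value
    [e = +oo] is allowed, as it turns membership in [L2] into finiteness of the integral. *)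
Lemma L2norm_lt mu f (e : \bar R) : (0 < e)%E ->
  (L2norm mu f < e)%E = (\int[mu]_x (cabs f x ^+ 2)%:E < e * e)%E.
Proof.
rewrite -(_ : (L2norm mu f * L2norm mu f = \int[mu]_x (cabs f x ^+ 2)%:E)%E).
  have : (0 <= L2norm mu f)%E by exact: Lnorm_ge0.
  case: (L2norm mu f) e => [a| |] [b| |]//=.
  - rewrite -!EFinM !lte_fin lee_fin => a0 b0.
    by rewrite -!expr2 ltr_pXn2r// nnegrE ltW.
  - by rewrite -?EFinM ?mulyy !ltry.
transitivity (L2norm mu f `^ 2)%E.
  have : (0 <= L2norm mu f)%E by exact: Lnorm_ge0.
  case: (L2norm mu f) => [a| |]//=.
    by rewrite lee_fin => a0; rewrite powR_mulrn// expr2.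
  by rewrite pnatr_eq0 ?mulyy.
rewrite poweR_Lnorm ?pnatr_eq0//; apply: eq_integral => x _.
by rewrite /= ger0_norm ?cabs_ge0// powR_mulrn// cabs_ge0.
Qed.

Lemma L2P mu f : L2 mu f <->
  cmeasurable f /\ (\int[mu]_x (cabs f x ^+ 2)%:E < +oo)%E.
Proof.
by rewrite -[X in (_ < X)%E]mulyy -L2norm_lt.
Qed.

End SquareIntegral.

(** * Transport of integrals along a transformation *)

Section Transport.
Context d (T : measurableType d) (R : realType).
Variable mu : {measure set T -> \bar R}.
Import HBNNSimple.
Local Open Scope ereal_scope.

(** The integrand splits over the level sets of [s] pulled back by [psi]. With [psi] the identity or
    [phi], this computes either side of the transport inequality for simple functions. *)
Lemma integral_nnsfun_comp (v : T -> R) (psi : T -> T) (s : {nnsfun T >-> R}) :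
  measurable_fun setT v -> (forall x, (0 <= v x)%R) -> measurable_fun setT psi ->
  \int[mu]_x (v x * s (psi x))%:E =
  \sum_(y \in range s) y%:E * \int[mu]_(x in psi @^-1` (s @^-1` [set y])) (v x)%:E.
Proof.
move=> mv v0 mpsi.
have mpre y : measurable (psi @^-1` (s @^-1` [set y])).
  by rewrite -[X in measurable X]setTI; exact: mpsi.
have mind y : measurable_fun setT
    (fun x => \1_(psi @^-1` (s @^-1` [set y])) x : R).
  exact: measurable_indic.
transitivity (\int[mu]_x \sum_(y \in range s)
    (y%:E * (v x * \1_(psi @^-1` (s @^-1` [set y])) x)%:E)).
  apply: eq_integral => x _.
  rewrite fimfunE EFinM -fsumEFin// ge0_mule_fsumr; last first.
    by move=> y; exact: nnfun_muleindic_ge0.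
  apply: eq_fsbigr => y _; rewrite -!EFinM; congr (_%:E).
  rewrite mulrCA; congr (_ * (_ * _))%R.
rewrite ge0_integral_fsum//; last 2 first.
- move=> y; apply: emeasurable_funM; first exact: measurable_cst.
  by apply/measurable_EFinP; exact: measurable_funM.
(* Nonnegativity is asked for every real [y]; for [y < 0] the level set is empty, because [s] is
   nonnegative. *)
- move=> y x _.
  have [y0|y0] := leP 0%R y; first by rewrite mule_ge0 ?lee_fin ?mulr_ge0.
  rewrite (_ : \1_ _ x = 0%R :> R) ?mulr0 ?mule0//.
  rewrite indicE memNset// => sy; move: y0; rewrite -sy ltNge => /negP; apply.
  exact: fun_ge0.
apply: eq_fsbigr => y; rewrite inE => -[t _ sty].
rewrite ge0_integralZl//; first last.
- by rewrite lee_fin -sty.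
- by move=> x _; rewrite lee_fin mulr_ge0.
- by apply/measurable_EFinP; exact: measurable_funM.
congr (_ * _); rewrite [RHS]integral_mkcond epatch_indic.
by apply: eq_integral => x _; rewrite EFinM.
Qed.

(** The inequality on sets passes to simple functions level set by level set, their values being
    nonnegative, and then to [g] by monotone convergence along increasing simple functions. *)
Lemma ge0_integral_transport (u v g : T -> R) (phi : T -> T) :
  measurable_fun setT u -> (forall x, (0 <= u x)%R) ->
  measurable_fun setT v -> (forall x, (0 <= v x)%R) ->
  measurable_fun setT g -> (forall x, (0 <= g x)%R) ->
  measurable_fun setT phi ->
  (forall A, measurable A ->
    \int[mu]_(x in A) (u x)%:E <= \int[mu]_(x in phi @^-1` A) (v x)%:E) ->
  \int[mu]_x (u x * g x)%:E <= \int[mu]_x (v x * g (phi x))%:E.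
Proof.
move=> mu_ u0 mv v0 mg g0 mphi uv.
have mEg : measurable_fun setT (EFin \o g) by exact/measurable_EFinP.
pose s := nnsfun_approx measurableT mEg.
have lim_ (t : T -> R) (psi : T -> T) : measurable_fun setT t ->
    (forall x, (0 <= t x)%R) -> measurable_fun setT psi ->
    \int[mu]_x (t x * s n (psi x))%:E @[n --> \oo] -->
    \int[mu]_x (t x * g (psi x))%:E.
  move=> mt t0 mpsi.
  rewrite (_ : \int[mu]_x (t x * g (psi x))%:E =
    \int[mu]_x (limn (fun n => (t x * s n (psi x))%:E))); last first.
    apply: eq_integral => x _; apply/esym/cvg_lim => //.
    under eq_fun do rewrite EFinM.
    rewrite EFinM; apply: cvgeZl => //.
    by apply: (cvg_nnsfun_approx measurableT mEg) => //= y _; rewrite lee_fin.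
  apply: cvg_monotone_convergence => //.
  - move=> n; apply/measurable_EFinP; apply: measurable_funM => //.
    exact: measurableT_comp.
  - by move=> n x _; rewrite lee_fin mulr_ge0.
  - move=> x _ m n mn; rewrite lee_fin ler_wpM2l//.
    exact/lefP/nd_nnsfun_approx.
rewrite -(cvg_lim _ (lim_ u id _ _ _))// -(cvg_lim _ (lim_ v phi _ _ _))//.
apply: lee_lim.
- by apply/cvg_ex; eexists; exact: (lim_ u id).
- by apply/cvg_ex; eexists; exact: (lim_ v phi).
apply: nearW => n; rewrite (@integral_nnsfun_comp u id)// integral_nnsfun_comp//.
apply: lee_fsum => [|y [t _ <-]]; first exact: fimfunP.
apply: lee_wpmul2l; first by rewrite lee_fin.
apply: uv; exact: measurable_funPTI.
Qed.

End Transport.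

(** * Pointwise estimate and density of the domain *)

(* For [b = 0] the left-hand side is [0], as [a / 0 = 0]. *)
Lemma sqr_powR_div_le (R : realType) (a b N alpha : R) :
  0 <= a -> 0 < N -> b = 0 \/ N^-1 <= b -> 0 < alpha <= 1 ->
  ((a / b) `^ (alpha / 2)) ^+ 2 <= 1 + N * a.
Proof.
move=> a0 N0 bN /andP[alpha0 alpha1].
have al2 : alpha / 2 != 0 by rewrite gt_eqF// divr_gt0.
case: bN => [->|Nb].
  by rewrite invr0 mulr0 powR0// expr0n/= addr_ge0// mulr_ge0// ltW.
have b0 : 0 < b by rewrite (lt_le_trans _ Nb)// invr_gt0.
have r0 : 0 <= a / b by rewrite divr_ge0// ltW.
have rN : a / b <= N * a.
  by rewrite mulrC ler_wpM2r// -[N]invrK lef_pV2// ?posrE// invr_gt0.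
rewrite -powR_mulrn ?powR_ge0// -powRrM divfK ?pnatr_eq0//.
(* With [t = a / b], [t^alpha] is at most [t <= N * a] if [t >= 1], and at most [1] otherwise. *)
have [r1|/ltW r1] := leP 1 (a / b).
  apply: (@le_trans _ _ ((a / b) `^ 1)); first exact: ler_powR.
  by rewrite powRr1// (le_trans rN)// lerDr.
apply: (@le_trans _ _ (1 `^ alpha)).
  by apply: ge0_ler_powR => //; exact: ltW.
by rewrite powR1 lerDl mulr_ge0// ltW.
Qed.

(** Each further power adds its factor on the outside, so the domains decrease with [k] and
    everything reduces to [k = 2]. *)
Lemma dom_op_pow_ge2 d (T : measurableType d) (R : realType)
    (mu : {measure set T -> \bar R}) (A : operator T R) (k : nat) f :
  (2 <= k)%N -> dom (op_pow mu A k) f -> dom A f /\ dom A (act A f).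
Proof.
case: k => [|[|k]]// _; elim: k => [[[_ ?] ?]//|k IH [/IH]//].
Qed.

Theorem proposition13 (R : realType) (d : measure_display)
    (T : measurableType d) (mu : {sigma_finite_measure set T -> \bar R})
    (w : T -> R[i]) (phi : T -> T) (h : T -> \bar R)
    (alpha : R) (w_alpha : T -> R[i]) (k : nat)
    (mw : cmeasurable w)
    (mphi : measurable_fun setT phi)
    (ac : pushforward (weighted mu w) phi `<< mu)
    (hh : is_h mu w phi h)
    (alpha_gt0 : 0 < alpha) (alpha_le1 : alpha <= 1)
    (hwa : is_w_alpha mu w phi h alpha w_alpha)
    (k_ge2 : (2 <= k)%N)
    (dense_k : densely_defined mu (op_pow mu (wcomp mu w phi) k)) :
  densely_defined mu (wcomp mu w_alpha phi).
Proof.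
case: hh => mh h0 hE; case: hwa => mwa waE.
pose a := fine \o h.
have ma : measurable_fun setT a.
  by apply: measurableT_comp mh; exact: fine_measurable.
have a0 x : 0 <= a x by exact: fine_ge0.
(* The sets behind [1_n], with [n + 1] for [n] so that the inverse is genuine at [n = 0]. Keeping
   the points where [a] is [0], among them those with [h = +oo], lets the sets exhaust the space. *)
pose S n := a @^-1` ([set 0] `|` `[n.+1%:R^-1, +oo[).
have mS n : measurable (S n).
  rewrite -[X in measurable X]setTI; apply: ma => //.
  by apply: measurableU => //; exact: measurable_itv.
have S_ev x : \forall n \near \oo, S n x.
  have [ax0|ax0] := eqVneq (a x) 0; first by apply: nearW => n; left.
  have ax : 0 < a x by rewrite lt_neqAle eq_sym ax0 a0.
  (* [Num.bound] exceeds [1 / a x], hence [1 / (n + 1) <= a x] from this index on. *)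
  exists (Num.bound (a x)^-1) => // n /= Nn; right.
  rewrite /= in_itv/= andbT invf_ple ?posrE//.
  have /archi_boundP/ltW : 0 <= (a x)^-1 by rewrite invr_ge0.
  by move=> /le_trans; apply; rewrite ler_nat (leq_trans Nn).
move=> g L2g e e0; have [mg g_fin] := (L2P _ _).1 L2g.
have [f /(dom_op_pow_ge2 k_ge2)/= [[L2f L2Cf] [_ L2CCf]] fg] := dense_k g L2g e e0.
have [mf f_fin] := (L2P _ _).1 L2f.
have [mCf Cf_fin] := (L2P _ _).1 L2Cf.
have [_ CCf_fin] := (L2P _ _).1 L2CCf.
have mI n : measurable_fun setT (\1_(S n) : T -> R) by exact: measurable_indic.
have mIC n : measurable_fun setT (\1_(~` S n) : T -> R).
  by apply: measurable_indic; exact: measurableC.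
(* [1_n f - g] is [f - g] where [1_n = 1] and [- g] elsewhere, so it is enough
   that the mass of [|g|^2] where [1_n = 0] vanishes in the limit. *)
have tail : (\int[mu]_x (\1_(~` S n) x * cabs g x ^+ 2)%:E)%E @[n --> \oo] --> 0%E.
  rewrite -[X in _ --> X](integral0 mu setT).
  have [] := @dominated_convergence _ _ _ mu setT measurableT
    (fun n x => (\1_(~` S n) x * cabs g x ^+ 2)%:E) (cst 0%E)
    (fun x => (cabs g x ^+ 2)%:E) => //.
  - move=> n; apply/measurable_EFinP; apply: measurable_funM => //.
    exact: measurable_sqr_cabs.
  - apply: aeW => x _; apply: cvg_near_cst; apply: filterS (S_ev x) => n Sn.
    by rewrite indicE memNset ?mul0r//; apply.
  - apply/integrableP; split.
      by apply/measurable_EFinP; exact: measurable_sqr_cabs.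
    by under eq_integral do rewrite /= ger0_norm ?sqr_ge0//.
  - apply: aeW => x n _; rewrite /= lee_fin ger0_norm ?mulr_ge0 ?cabs_ge0//.
    by rewrite ler_piMl ?sqr_ge0// indicE lern1 leq_b1.
rewrite L2norm_lt ?lte_fin// -EFinM in fg.
have fg_fin : (\int[mu]_x (cabs (fun y => (f y - g y)%R) x ^+ 2)%:E \is a fin_num)%E.
  rewrite ge0_fin_numE; first by rewrite (lt_trans fg)// ltry.
  by apply: integral_ge0 => x _; rewrite lee_fin sqr_ge0.
(* The strict inequality for [f - g] leaves positive room below [e^2], and [N] is chosen so that the
   tail of [g] fits in it; hence [f] could be taken within [e] itself of [g]. *)
have [N tail_N] : exists n, (\int[mu]_x (\1_(~` S n) x * cabs g x ^+ 2)%:E <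
    (e * e)%:E - \int[mu]_x (cabs (fun y => (f y - g y)%R) x ^+ 2)%:E)%E.
  have /open_ereal_lt'/tail[M _ MP] : (0 < (e * e)%:E -
      \int[mu]_x (cabs (fun y => (f y - g y)%R) x ^+ 2)%:E)%E by rewrite sube_gt0.
  by exists M; apply: MP => /=.
pose fn x := f x * real_complex R (\1_(S N) x).
have mfn : cmeasurable fn by apply: cmeasurableM => //; exact: cmeasurable_real.
have cabs_fn x : cabs fn x ^+ 2 = cabs f x ^+ 2 * \1_(S N) x.
  rewrite cabsM exprMn cabs_real indicE.
  by case: (x \in S N); rewrite ?normr1 ?normr0 ?expr1n ?expr0n.
have mfg : cmeasurable (fun y => f y - g y) by exact: cmeasurableB.
exists fn; last first.
  rewrite L2norm_lt ?lte_fin// -EFinM.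
  apply: (@le_lt_trans _ _ (\int[mu]_x ((cabs (fun y => (f y - g y)%R) x ^+ 2)%:E +
     (\1_(~` S N) x * cabs g x ^+ 2)%:E))%E).
    apply: ge0_le_integral => //.
    - by move=> x _; rewrite lee_fin sqr_ge0.
    - apply/measurable_EFinP; apply: measurable_sqr_cabs; exact: cmeasurableB.
    - apply: emeasurable_funD; apply/measurable_EFinP.
        by apply: measurable_sqr_cabs.
      by apply: measurable_funM => //; exact: measurable_sqr_cabs.
    move=> x _; rewrite -EFinD lee_fin /cabs /fn !indicE in_setC.
    case: (x \in S N); first by rewrite rmorph1 mulr1 mul0r addr0.
    by rewrite rmorph0 mulr0 sub0r (@normcN R) mul1r lerDr sqr_ge0.
  rewrite ge0_integralD//.
  - by rewrite addeC -lteBrDr.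
  - by move=> x _; rewrite lee_fin sqr_ge0.
  - by apply/measurable_EFinP; exact: measurable_sqr_cabs.
  - by move=> x _; rewrite lee_fin mulr_ge0// sqr_ge0.
  - apply/measurable_EFinP; apply: measurable_funM => //.
    exact: measurable_sqr_cabs.
(* [fn] is in [L^2] because [|fn| <= |f|]; the rest of the proof bounds the integral of
   [|w_alpha|^2 |fn \o phi|^2]. *)
split; apply/L2P; split => //.
- apply: le_lt_trans f_fin; apply: ge0_le_integral => //.
  + by move=> x _; rewrite lee_fin sqr_ge0.
  + by apply/measurable_EFinP; exact: measurable_sqr_cabs.
  + by apply/measurable_EFinP; exact: measurable_sqr_cabs.
  + move=> x _; rewrite lee_fin cabs_fn ler_piMr ?sqr_ge0// indicE lern1 leq_b1.
- by apply: cmeasurableM => //; exact: cmeasurable_comp.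
(* [fine h] is [0] where [h = +oo], so only one inequality of the change of
   variables is available, and it suffices. *)
have Ca : (\int[mu]_x (a x * cabs (fun x => (w x * f (phi x))%R) x ^+ 2)%:E < +oo)%E.
  apply: le_lt_trans CCf_fin.
  (* The integrand of [||C^2 f||^2] becomes [|w|^2] times [|C f|^2 \o phi], ready for transport with
     weight [v = |w|^2]. *)
  under [leRHS]eq_integral do rewrite cabsM exprMn.
  apply: (ge0_integral_transport (phi := phi) (v := fun x => cabs w x ^+ 2)
    (g := fun x => cabs (fun x => (w x * f (phi x))%R) x ^+ 2)) => //.
  - exact: measurable_sqr_cabs.
  - by move=> x; exact: sqr_ge0.
  - exact: measurable_sqr_cabs.
  - by move=> x; exact: sqr_ge0.
  move=> A mA; have := hE A mA; rewrite /pushforward /weighted => ->.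
  apply: ge0_le_integral => //.
  - by move=> x _; rewrite lee_fin.
  - by apply/measurable_EFinP; exact: measurable_funTS.
  - exact: measurable_funTS.
  - by move=> x _; rewrite /a /=; move: (h0 x); case: (h x) => //= *; exact: leey.
set Cf := fun x => w x * f (phi x) in mCf Cf_fin Ca.
have mCf2 : measurable_fun setT (fun x => (cabs Cf x ^+ 2)%:E).
  by apply/measurable_EFinP; exact: measurable_sqr_cabs.
have maCf2 : measurable_fun setT (fun x => (a x * cabs Cf x ^+ 2)%:E).
  apply/measurable_EFinP; apply: measurable_funM => //.
  exact: measurable_sqr_cabs.
have maCf2N : measurable_fun setT
    (fun x => N.+1%:R%:E * (a x * cabs Cf x ^+ 2)%:E)%E.
  by apply: emeasurable_funM => //; exact: measurable_cst.
have Cf2_ge0 x : (0 <= (cabs Cf x ^+ 2)%:E)%E by rewrite lee_fin sqr_ge0.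
have aCf2_ge0 x : (0 <= (a x * cabs Cf x ^+ 2)%:E)%E.
  by rewrite lee_fin mulr_ge0// sqr_ge0.
have aCf2N_ge0 x : (0 <= N.+1%:R%:E * (a x * cabs Cf x ^+ 2)%:E)%E.
  by rewrite mule_ge0.
(* The majorant is [(1 + (N + 1) a) |C f|^2], integrable by [Cf_fin] and [Ca]. *)
apply: (@le_lt_trans _ _ (\int[mu]_x ((cabs Cf x ^+ 2)%:E +
    N.+1%:R%:E * (a x * cabs Cf x ^+ 2)%:E))%E); last first.
  rewrite ge0_integralD// ge0_integralZl//.
  by rewrite lte_add_pinfty// lte_mul_pinfty.
apply: ae_ge0_le_integral => //.
- by move=> x _; rewrite lee_fin sqr_ge0.
- apply/measurable_EFinP; apply: measurable_sqr_cabs; apply: cmeasurableM => //.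
  exact: cmeasurable_comp.
- by move=> x _; exact: adde_ge0.
- exact: emeasurable_funD.
move: waE; apply: filterS => x wax _.
have -> : cabs (fun x => w_alpha x * fn (phi x)) x ^+ 2 =
    (cabs w x * (a x / a (phi x)) `^ (alpha / 2)) ^+ 2 * cabs fn (phi x) ^+ 2.
  rewrite cabsM exprMn; congr (_ ^+ 2 * _).
  by rewrite /cabs wax Normc.normcM /= expr0n addr0 sqrtr_sqr ger0_norm// powR_ge0.
rewrite -!EFinM -EFinD lee_fin cabs_fn cabsM !exprMn.
(* Both sides share the factor [|C f|^2], named [W] below; taking it out leaves a scalar
   inequality. *)
rewrite [leRHS](_ : _ = cabs w x ^+ 2 * cabs f (phi x) ^+ 2 * (1 + N.+1%:R * a x));
  last by rewrite /cabs; ring.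
rewrite mulrACA mulrA; set W := _ * cabs f _ ^+ 2.
have W0 : 0 <= W by rewrite mulr_ge0 ?sqr_ge0.
rewrite indicE -mulrA; apply: ler_wpM2l => //.
(* The indicator is evaluated at [phi x], so it controls the denominator [a (phi x)]: off [S N] the
   left-hand side is [0], and on [S N] the denominator is [0] or at least [1 / (N + 1)], the two
   cases of [sqr_powR_div_le]. *)
have [|_] := boolP (phi x \in S N); last by rewrite mulr0 addr_ge0// mulr_ge0.
rewrite inE mulr1 => -[aphi0|]; last rewrite /= in_itv/= andbT => aphiN.
  by apply: sqr_powR_div_le => //; [left|rewrite alpha_gt0].
by apply: sqr_powR_div_le => //; [right|rewrite alpha_gt0].
Qed.
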